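(* Let $\mathcal{C}$ be a rigid monoidal category acting linearly from the right on a finite abelian category $\mathcal{M}$, and let $\Sigma:\mathcal{M}\to\mathcal{M}$ be a $k$-linear right exact functor equipped with a structure $\Psi^{\Sigma}_{M,X}:\Sigma(M)\triangleleft X^{**}\to\Sigma(M\triangleleft X)$ of a twisted right $\mathcal{C}$-module functor. Suppose that a $\Sigma$-twisted trace $\mathtt{t}_\bullet$ on $\mathrm{Proj}(\mathcal{M})$ corresponds to a natural transformation $\xi:\Sigma\to\mathbb{N}_{\mathcal{M}}$ via the bijection $\mathrm{Nat}(\Sigma,\mathbb{N}_{\mathcal{M}})\cong\{\Sigma\text{-twisted traces on }\mathrm{Proj}(\mathcal{M})\}$ given by $\mathtt{t}_P(f)=\widetilde{\mathtt{t}}_P(\xi_P\circ f)$ for $P\in\mathrm{Proj}(\mathcal{M})$ and $f:P\to\Sigma(P)$. Then $\mathtt{t}_\bullet$ is compatible with the right $\mathcal{C}$-module structure if and only if $\xi$ is a morphism of twisted right $\mathcal{C}$-module functors.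
   Context: Let $k$ be a field; $V^*$ denotes the dual of a vector space $V$. A finite abelian category is a $k$-linear category equivalent to the category of finite-dimensional left modules over a finite-dimensional $k$-algebra. $\mathrm{Proj}(\mathcal{M})$ is the full subcategory of projective objects of $\mathcal{M}$. Canonical action: for a finite-dimensional vector space $V$ and $M\in\mathcal{M}$, $V\cdot M\in\mathcal{M}$ is defined by the natural isomorphism $\mathrm{Hom}_{\mathcal{M}}(V\cdot M,N)\cong\mathrm{Hom}_k(V,\mathrm{Hom}_{\mathcal{M}}(M,N))$. Every $k$-linear functor $F$ between finite abelian categories has canonical isomorphisms $V\cdot F(M)\cong F(V\cdot M)$; in particular $V\otimes_k\mathrm{Hom}_{\mathcal{M}}(M,M')\cong\mathrm{Hom}_{\mathcal{M}}(M,V\cdot M')$. Nakayama functor: $\mathbb{N}_{\mathcal{M}}(M)=\int^{X\in\mathcal{M}}\mathrm{Hom}_{\mathcal{M}}(M,X)^*\cdot X$, with universal dinatural transformation $\mathbb{i}_{X,M}:\mathrm{Hom}_{\mathcal{M}}(M,X)^*\cdot X\to\mathbb{N}_{\mathcal{M}}(M)$. A $\Sigma$-twisted trace on $\mathrm{Proj}(\mathcal{M})$ is a family of $k$-linear maps $\mathtt{t}_P:\mathrm{Hom}_{\mathcal{M}}(P,\Sigma(P))\to k$ ($P\in\mathrm{Proj}(\mathcal{M})$) with $\mathtt{t}_P(g\circ f)=\mathtt{t}_Q(\Sigma(f)\circ g)$ for all $P,Q\in\mathrm{Proj}(\mathcal{M})$, $f:P\to Q$, $g:Q\to\Sigma(P)$.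 Canonical Nakayama-twisted trace: $\widetilde{\mathtt{t}}_P:\mathrm{Hom}_{\mathcal{M}}(P,\mathbb{N}_{\mathcal{M}}(P))\to k$ ($P$ projective) is the unique linear map with $\widetilde{\mathtt{t}}_P(\mathbb{i}_{X,P}\circ\Lambda(\omega,f))=\omega(f)$ for all $X\in\mathcal{M}$, $\omega\in\mathrm{Hom}_{\mathcal{M}}(P,X)^*$, $f\in\mathrm{Hom}_{\mathcal{M}}(P,X)$, where $\Lambda(\omega,f)$ is the image of $\omega\otimes f$ under $\mathrm{Hom}_{\mathcal{M}}(P,X)^*\otimes_k\mathrm{Hom}_{\mathcal{M}}(P,X)\cong\mathrm{Hom}_{\mathcal{M}}(P,\mathrm{Hom}_{\mathcal{M}}(P,X)^*\cdot X)$. Monoidal and module categories are assumed strict. In the rigid monoidal category $\mathcal{C}$, $X^*$ is the left dual of $X$ with $\mathrm{ev}_X:X^*\otimes X\to\mathbb{1}$, $\mathrm{coev}_X:\mathbb{1}\to X\otimes X^*$, and the duality functors are assumed strict monoidal and mutually inverse. ''$\mathcal{C}$ acts linearly on $\mathcal{M}$ from the right'' means that $\mathcal{M}$ is a right $\mathcal{C}$-module category with action $\triangleleft:\mathcal{M}\times\mathcal{C}\to\mathcal{M}$ such that each $(-)\triangleleft X$ is $k$-linear. A twisted right $\mathcal{C}$-module functor is a functor $\Sigma:\mathcal{M}\to\mathcal{M}$ with a natural transformation (automatically invertible) $\Psi^{\Sigma}_{M,X}:\Sigma(M)\triangleleft X^{**}\to\Sigma(M\triangleleft X)$ such that $\Psi^\Sigma_{M,\mathbb{1}}=\mathrm{id}$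 and $\Psi^{\Sigma}_{M,X\otimes Y}=\Psi^\Sigma_{M\triangleleft X,Y}\circ(\Psi^\Sigma_{M,X}\triangleleft\mathrm{id}_{Y^{**}})$. A morphism $\xi:\Sigma\to\Sigma'$ of such functors is a natural transformation with $\xi_{M\triangleleft X}\circ\Psi^{\Sigma}_{M,X}=\Psi^{\Sigma'}_{M,X}\circ(\xi_M\triangleleft\mathrm{id}_{X^{**}})$. Closing operator: $\mathrm{cl}_{M,N|X}:\mathrm{Hom}_{\mathcal{M}}(M\triangleleft X,N\triangleleft X^{**})\to\mathrm{Hom}_{\mathcal{M}}(M,N)$, $\mathrm{cl}_{M,N|X}(f)=(\mathrm{id}_N\triangleleft\mathrm{ev}_{X^*})\circ(f\triangleleft\mathrm{id}_{X^*})\circ(\mathrm{id}_M\triangleleft\mathrm{coev}_X)$. A $\Sigma$-twisted trace $\mathtt{t}_\bullet$ is compatible with the right $\mathcal{C}$-module structure if $\mathtt{t}_P(\mathrm{cl}_{P,\Sigma(P)|X}(f))=\mathtt{t}_{P\triangleleft X}(\Psi^\Sigma_{P,X}\circ f)$ for all $P\in\mathrm{Proj}(\mathcal{M})$, $X\in\mathcal{C}$, $f:P\triangleleft X\to\Sigma(P)\triangleleft X^{**}$ (note $P\triangleleft X$ is projective). Twisted module structure of $\mathbb{N}=\mathbb{N}_{\mathcal{M}}$: $\Psi^{\mathbb{N}}_{M,V}:\mathbb{N}(M)\triangleleft V^{**}\to\mathbb{N}(M\triangleleft V)$ is the unique morphism such that for all $X\in\mathcal{M}$, $\Psi^{\mathbb{N}}_{M,V}\circ(\mathbb{i}_{X,M}\triangleleft\mathrm{id}_{V^{**}})=\mathbb{i}_{X\triangleleft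 V^{**},M\triangleleft V}\circ((\mathrm{cl}_{M,X|V})^*\cdot\mathrm{id}_{X\triangleleft V^{**}})\circ\mathrm{can}$, where $\mathrm{can}:(\mathrm{Hom}_{\mathcal{M}}(M,X)^*\cdot X)\triangleleft V^{**}\cong\mathrm{Hom}_{\mathcal{M}}(M,X)^*\cdot(X\triangleleft V^{**})$ is the canonical isomorphism. *)

(* Defs.v *)
From HB Require Import structures.
From mathcomp Require Import all_boot all_order all_algebra.
From mathcomp Require Import boolp.

Set Implicit Arguments.
Unset Strict Implicit.
Unset Printing Implicit Defensive.

Import GRing.Theory.
Local Open Scope ring_scope.

Declare Scope cat_scope.
Delimit Scope cat_scope with cat.
Local Open Scope cat_scope.

(* Finite-dimensionality of the Hom spaces ([vectType]) is automatic for a *)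
(* finite abelian category.                                                *)

Record linCat (k : fieldType) := LinCat {
  obj :> Type;
  Mor : obj -> obj -> vectType k;
  idM : forall A, Mor A A;
  mcomp : forall A B D, Mor B D -> Mor A B -> Mor A D;
  comp1m : forall A B (f : Mor A B), mcomp (idM B) f = f;
  compm1 : forall A B (f : Mor A B), mcomp f (idM A) = f;
  mcompA : forall A B D E (h : Mor D E) (g : Mor B D) (f : Mor A B),
    mcomp h (mcomp g f) = mcomp (mcomp h g) f;
  comp_linr : forall A B D (g : Mor B D), linear (@mcomp A B D g);
  comp_linl : forall A B D (f : Mor A B),
    linear (fun g : Mor B D => mcomp g f) }.

Arguments Mor {k l} _ _.
Arguments idM {k l} A.
Arguments mcomp {k l A B D} _ _.

Notation "g ∘ f" := (mcomp g f) (at level 40, left associativity) : cat_scope.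

Definition compr (k : fieldType) (M : linCat k) (A B D : M) (f : Mor A B)
  (g : Mor B D) : Mor A D := g ∘ f.

HB.instance Definition _ (k : fieldType) (M : linCat k) (A B D : M)
    (g : Mor B D) :=
  GRing.isLinear.Build k (Mor A B) (Mor A D) *:%R (mcomp g) (comp_linr g).

HB.instance Definition _ (k : fieldType) (M : linCat k) (A B D : M)
    (f : Mor A B) :=
  GRing.isLinear.Build k (Mor B D) (Mor A D) *:%R (compr f) (comp_linl f).

(* [homL f] = Hom(A, f) and [homR f] = Hom(f, X). *)
Definition homL (k : fieldType) (M : linCat k) (A X Y : M) (f : Mor X Y) :
  'Hom(Mor A X, Mor A Y) := linfun (mcomp f).
Definition homR (k : fieldType) (M : linCat k) (X A B : M) (f : Mor A B) :
  'Hom(Mor B X, Mor A X) := linfun (compr f).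

(* The morphism underlying an equality of objects.  Strict structures are  *)
(* equalities of objects; [eqm] transports morphisms along them.           *)
Definition eqm (k : fieldType) (M : linCat k) (A B : M) (e : A = B) :
  Mor A B := let: erefl := e in idM A.

Definition epi (k : fieldType) (M : linCat k) (A B : M) (e : Mor A B) :=
  forall (Z : M) (u v : Mor B Z), u ∘ e = v ∘ e -> u = v.

Definition projective (k : fieldType) (M : linCat k) (P : M) :=
  forall (A B : M) (e : Mor A B), epi e ->
  forall g : Mor P B, exists h : Mor P A, e ∘ h = g.

Record Proj (k : fieldType) (M : linCat k) := MkProj {
  proj_obj :> obj M;
  proj_objP : projective proj_obj }.

Definition is_cokernel (k : fieldType) (M : linCat k) (A B D : M)
    (f : Mor A B) (g : Mor B D) :=
  g ∘ f = 0 /\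
  forall (Z : M) (h : Mor B Z), h ∘ f = 0 -> exists! u : Mor D Z, u ∘ g = h.

Record functor (k : fieldType) (M N : linCat k) := Functor {
  fobj :> M -> N;
  fmor : forall A B : M, Mor A B -> Mor (fobj A) (fobj B);
  fmor_id : forall A : M, fmor (idM A) = idM (fobj A);
  fmor_comp : forall (A B D : M) (g : Mor B D) (f : Mor A B),
    fmor (g ∘ f) = fmor g ∘ fmor f }.

Arguments fmor {k M N} _ {A B} _.

Definition functor_id (k : fieldType) (M : linCat k) : functor M M :=
  @Functor k M M (fun A => A) (fun _ _ f => f) (fun=> erefl)
    (fun _ _ _ _ _ => erefl).

Definition functor_comp (k : fieldType) (M N L : linCat k)
  (G : functor N L) (F : functor M N) : functor M L.
Proof.
exists (fun A => G (F A)) (fun A B f => fmor G (fmor F f)).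
- by move=> A; rewrite !fmor_id.
- by move=> A B D g f; rewrite !fmor_comp.
Defined.

Definition linear_functor (k : fieldType) (M N : linCat k)
    (F : functor M N) :=
  forall A B : M, linear (@fmor k M N F A B).

(* Between abelian categories and for additive functors, preserving        *)
(* cokernels means sending exact sequences A -> B -> D -> 0 to such.       *)
Definition right_exact (k : fieldType) (M N : linCat k) (F : functor M N) :=
  forall (A B D : M) (f : Mor A B) (g : Mor B D),
    is_cokernel f g -> is_cokernel (fmor F f) (fmor F g).

Record nattrans (k : fieldType) (M N : linCat k) (F G : functor M N) :=
  NatTrans {
    ntmor :> forall A : M, Mor (F A) (G A);
    nt_nat : forall (A B : M) (f : Mor A B),
      ntmor B ∘ fmor F f = fmor G f ∘ ntmor A }.

Definition isomorphic_functors (k : fieldType) (M N : linCat k)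
    (F G : functor M N) :=
  exists (a : nattrans F G) (b : nattrans G F),
    forall A : M, b A ∘ a A = idM (F A) /\ a A ∘ b A = idM (G A).

Definition linear_equivalent (k : fieldType) (M N : linCat k) :=
  exists (F : functor M N) (G : functor N M),
    [/\ linear_functor F, linear_functor G,
        isomorphic_functors (functor_comp G F) (functor_id M) &
        isomorphic_functors (functor_comp F G) (functor_id N)].

(* [falgType] is not used since it excludes the zero algebra.              *)

Record fdAlg (k : fieldType) := FdAlg {
  acar :> vectType k;
  amul : acar -> acar -> acar;
  aone : acar;
  amulA : associative amul;
  amul1a : left_id aone amul;
  amula1 : right_id aone amul;
  amul_linr : forall a, linear (amul a);
  amul_linl : forall b, linear (fun a => amul a b) }.

Record fdMod (k : fieldType) (R : fdAlg k) := FdMod {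
  mcar :> vectType k;
  mod_act : R -> mcar -> mcar;
  mod_act1 : forall v, mod_act (aone R) v = v;
  mod_actM : forall a b v, mod_act (amul a b) v = mod_act a (mod_act b v);
  mod_act_linr : forall a, linear (mod_act a);
  mod_act_linl : forall v, linear (fun a => mod_act a v) }.

Section ModuleCategory.
Variables (k : fieldType) (R : fdAlg k).
Implicit Types U V W : fdMod R.

HB.instance Definition _ V (a : R) :=
  GRing.isLinear.Build k V V *:%R (mod_act a) (mod_act_linr a).

Definition defect V W (f : 'Hom(V, W)) (a : R) : 'Hom(V, W) :=
  (f \o linfun (mod_act a))%VF - (linfun (mod_act a) \o f)%VF.

Lemma defectE V W (f : 'Hom(V, W)) a v :
  defect f a v = f (mod_act a v) - mod_act a (f v).
Proof. by rewrite add_lfunE opp_lfunE !comp_lfunE !lfunE. Qed.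

Lemma defect_linear V W (f : 'Hom(V, W)) : linear (defect f).
Proof.
move=> c a b; apply/lfunP=> v.
rewrite [RHS]add_lfunE scale_lfunE !defectE !mod_act_linl !linearP /=.
by rewrite scalerBr scalerN addrACA.
Qed.

HB.instance Definition _ V W (f : 'Hom(V, W)) :=
  GRing.isLinear.Build k R 'Hom(V, W) *:%R (defect f) (defect_linear f).

Definition defectL V W (f : 'Hom(V, W)) : 'Hom(R, 'Hom(V, W)) :=
  linfun (defect f).

Lemma defectL_linear V W : linear (@defectL V W).
Proof.
move=> c f g; apply/lfunP=> a; apply/lfunP=> v.
rewrite [X in _ = fun_of_lfun X v]add_lfunE.
rewrite [X in _ = fun_of_lfun (X + _) v]scale_lfunE [RHS]add_lfunE scale_lfunE.
rewrite !(lfunE (defect _)) /= !defectE.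
rewrite !add_lfunE !scale_lfunE !linearP /=.
by rewrite scalerBr scalerN addrACA.
Qed.

HB.instance Definition _ V W :=
  GRing.isLinear.Build k 'Hom(V, W) 'Hom(R, 'Hom(V, W)) *:%R (@defectL V W)
    (@defectL_linear V W).

Definition modhom V W : {vspace 'Hom(V, W)} := lker (linfun (@defectL V W)).

Lemma modhomP V W (f : 'Hom(V, W)) :
  f \in modhom V W <-> forall a v, f (mod_act a v) = mod_act a (f v).
Proof.
rewrite memv_ker lfunE /=; split=> [/eqP f0 a v|fP].
  apply/eqP; rewrite -subr_eq0 -defectE.
  have -> : defect f a = defectL f a by rewrite lfunE.
  by rewrite f0 !zero_lfunE.
apply/eqP/lfunP=> a; apply/lfunP=> v.
by rewrite lfunE /= defectE fP subrr !zero_lfunE.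
Qed.

Definition modcomp U V W (g : subvs_of (modhom V W))
    (f : subvs_of (modhom U V)) : subvs_of (modhom U W) :=
  vsproj (modhom U W) (vsval g \o vsval f)%VF.

Lemma modcompE U V W (g : subvs_of (modhom V W)) (f : subvs_of (modhom U V)) :
  vsval (modcomp g f) = (vsval g \o vsval f)%VF.
Proof.
apply: vsprojK; apply/modhomP=> a v; rewrite !comp_lfunE.
have /modhomP -> := subvsP f; by have /modhomP -> := subvsP g.
Qed.

Lemma vsvalP V W c (f g : subvs_of (modhom V W)) :
  vsval (c *: f + g) = c *: vsval f + vsval g.
Proof. exact: linearP. Qed.

Lemma modcomp_linr U V W (g : subvs_of (modhom V W)) :
  linear (@modcomp U V W g).
Proof.
move=> c f f'; apply: (can_inj (@vsvalK _ _ _)).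
by rewrite vsvalP !modcompE vsvalP comp_lfunDr comp_lfunZr.
Qed.

Lemma modcomp_linl U V W (f : subvs_of (modhom U V)) :
  linear (fun g => @modcomp U V W g f).
Proof.
move=> c g g'; apply: (can_inj (@vsvalK _ _ _)).
by rewrite vsvalP !modcompE vsvalP comp_lfunDl comp_lfunZl.
Qed.

Definition modid V : subvs_of (modhom V V) := vsproj (modhom V V) \1%VF.

Lemma modidE V : vsval (modid V) = \1%VF.
Proof. by apply: vsprojK; apply/modhomP=> a v; rewrite !id_lfunE. Qed.

Definition modcat : linCat k.
Proof.
apply: (@LinCat k (fdMod R) (fun V W => subvs_of (modhom V W)) modid modcomp).
- by move=> V W f; apply: val_inj; rewrite /= modcompE modidE comp_lfun1l.
- by move=> V W f; apply: val_inj; rewrite /= modcompE modidE comp_lfun1r.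
- by move=> V W U T h g f; apply: val_inj; rewrite /= !modcompE comp_lfunA.
- exact: modcomp_linr.
- exact: modcomp_linl.
Defined.

End ModuleCategory.

Definition finite_abelian (k : fieldType) (M : linCat k) :=
  exists R : fdAlg k, linear_equivalent M (modcat R).

Notation dual V := 'Hom(V, GRing.regular _).

Section DualMap.
Variables (k : fieldType) (V W : vectType k) (a : 'Hom(V, W)).

Definition precomp (w : dual W) : dual V := (w \o a)%VF.

Lemma precomp_linear : linear precomp.
Proof. by move=> c u v; rewrite /precomp comp_lfunDl comp_lfunZl. Qed.

HB.instance Definition _ :=
  GRing.isLinear.Build k (dual W) (dual V) *:%R precomp precomp_linear.

Definition dualmap : 'Hom(dual W, dual V) := linfun precomp.

End DualMap.

(* The canonical action [V . A] of finite-dimensional vector spaces, given *)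
(* by a choice of representing objects for Hom_k(V, Hom(A, -)); it exists  *)
(* in every finite abelian category and is unique up to unique isomorphism.*)
Record canAction (k : fieldType) (M : linCat k) := CanAction {
  cact :> vectType k -> M -> M;
  cact_adj : forall (V : vectType k) (A B : M),
    Mor (cact V A) B -> 'Hom(V, Mor A B);
  cact_adjV : forall (V : vectType k) (A B : M),
    'Hom(V, Mor A B) -> Mor (cact V A) B;
  cact_adjK : forall V A B, cancel (@cact_adj V A B) (@cact_adjV V A B);
  cact_adjVK : forall V A B, cancel (@cact_adjV V A B) (@cact_adj V A B);
  cact_adj_nat : forall V A B B' (g : Mor B B') (h : Mor (cact V A) B),
    cact_adj (g ∘ h) = (homL A g \o cact_adj h)%VF }.

Arguments cact_adj {k M} _ {V A B} _.
Arguments cact_adjV {k M} _ {V A B} _.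

Section CanonicalAction.
Variables (k : fieldType) (M : linCat k) (T : canAction M).
Implicit Types (V W : vectType k) (A B : M).

Definition cact_unit V A : 'Hom(V, Mor A (T V A)) := cact_adj T (idM (T V A)).

(* [Lambda w f] is the image of w (x) f under the canonical isomorphism    *)
(* V (x) Hom(P, A) = Hom(P, V . A).                                        *)
Definition Lambda V (P A : M) (w : V) (f : Mor P A) : Mor P (T V A) :=
  cact_unit V A w ∘ f.

(* The morphism a . f : V . A -> W . B.                                    *)
Definition cact_map V W A B (a : 'Hom(V, W)) (f : Mor A B) :
    Mor (T V A) (T W B) :=
  cact_adjV T (homR (T W B) f \o cact_unit W B \o a)%VF.

Definition scalar_hom V A (w : dual V) : 'Hom(V, Mor A A) :=
  (linfun (fun c : GRing.regular k => (c : k) *: idM A) \o w)%VF.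

(* The canonical isomorphism F(V . A) = V . F(A) of a linear functor,      *)
(* written in a basis of V; by [can_iso_unit] and [can_isoK] it is inverse *)
(* to the morphism V . F(A) -> F(V . A) induced by the maps F(Lambda v id).*)
Definition can_iso (F : functor M M) V A : Mor (F (T V A)) (T V (F A)) :=
  \sum_(i < \dim {:V})
     cact_unit V (F A) (vbasis {:V})`_i
       ∘ fmor F (cact_adjV T (scalar_hom A (linfun (coord (vbasis {:V}) i : V -> k^o)))).

Lemma cact_adjE V A B (h : Mor (T V A) B) v :
  cact_adj T h v = h ∘ cact_unit V A v.
Proof.
by rewrite -[in LHS](compm1 h) cact_adj_nat comp_lfunE lfunE.
Qed.

Lemma cact_hom_eq V A B (g h : Mor (T V A) B) :
  (forall v, g ∘ cact_unit V A v = h ∘ cact_unit V A v) -> g = h.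
Proof.
move=> gh; rewrite -[g](cact_adjK) -[h](cact_adjK); congr (cact_adjV T).
by apply/lfunP=> v; rewrite (cact_adjE g) gh -(cact_adjE h).
Qed.

Lemma cact_adjV_unit V A B (a : 'Hom(V, Mor A B)) v :
  cact_adjV T a ∘ cact_unit V A v = a v.
Proof. by rewrite -cact_adjE cact_adjVK. Qed.

Lemma compDl A B D (f : Mor A B) (g h : Mor B D) :
  (g + h) ∘ f = g ∘ f + h ∘ f.
Proof. exact: (linearD (compr f)). Qed.

Lemma comp_sumr A B D (g : Mor B D) n (f : 'I_n -> Mor A B) :
  g ∘ (\sum_i f i) = \sum_i g ∘ f i.
Proof. exact: linear_sum. Qed.

Lemma comp_suml A B D n (g : 'I_n -> Mor B D) (f : Mor A B) :
  (\sum_i g i) ∘ f = \sum_i g i ∘ f.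
Proof. exact: (linear_sum (compr f)). Qed.

Lemma compZr A B D c (g : Mor B D) (f : Mor A B) : g ∘ (c *: f) = c *: (g ∘ f).
Proof. exact: linearZ. Qed.

Lemma scalar_homE V A (w : dual V) v : scalar_hom A w v = (w v : k) *: idM A.
Proof.
rewrite /scalar_hom comp_lfunE.
have lin : linear (fun c : GRing.regular k => (c : k) *: idM A).
  by move=> a b c; rewrite scalerDl -scalerA.
pose L := GRing.isLinear.Build k (GRing.regular k) (Mor A A) *:%R
  (fun c : GRing.regular k => (c : k) *: idM A) lin.
pose F : {linear GRing.regular k -> Mor A A} := HB.pack (fun c : GRing.regular k => (c : k) *: idM A) L.
exact: (lfunE F).
Qed.

Lemma can_iso_unit (F : functor M M) (linF : linear_functor F) V A v :
  can_iso F V A ∘ fmor F (cact_unit V A v) = cact_unit V (F A) v.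
Proof.
rewrite comp_suml.
rewrite [in RHS](coord_vbasis (memvf v)) linear_sum; apply: eq_bigr => i _.
rewrite -mcompA -fmor_comp cact_adjV_unit scalar_homE lfunE /= linearZ /=.
have -> (c : k) : fmor F (c *: idM A) = c *: idM (F A).
  have := linF A A c (idM A) 0; rewrite addr0 fmor_id => ->.
  suff -> : fmor F (0 : Mor A A) = 0 by rewrite addr0.
  by have := linF A A (-1) 0 0; rewrite scaler0 addr0 scaleN1r addNr.
by rewrite compZr compm1.
Qed.

Lemma can_isoK (F : functor M M) (linF : linear_functor F) V A
    (c : Mor (T V (F A)) (F (T V A))) :
  (forall v, c ∘ cact_unit V (F A) v = fmor F (cact_unit V A v)) ->
  c ∘ can_iso F V A = idM _ /\ can_iso F V A ∘ c = idM _.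
Proof.
move=> cE; split; last first.
  by apply: cact_hom_eq => v; rewrite -mcompA cE can_iso_unit // comp1m.
have F0 B B' : fmor F (0 : Mor B B') = 0.
  by have := linF B B' (-1) 0 0; rewrite scaler0 addr0 scaleN1r addNr.
have FD B B' : {morph (@fmor _ _ _ F B B') : x y / x + y}.
  by move=> x y; have := linF B B' 1 x y; rewrite !scale1r.
rewrite comp_sumr -[RHS]fmor_id.
under eq_bigr => i _ do rewrite mcompA cE -fmor_comp.
rewrite -(big_morph (fmor F) (@FD _ _) (F0 _ _)); congr (fmor F _).
apply: cact_hom_eq => v; rewrite comp_suml comp1m.
rewrite [in RHS](coord_vbasis (memvf v)) linear_sum; apply: eq_bigr => i _.
by rewrite -mcompA cact_adjV_unit scalar_homE lfunE /= !linearZ /= compm1.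
Qed.

End CanonicalAction.

Record category := Category {
  cob :> Type;
  chom : cob -> cob -> Type;
  idC : forall X, chom X X;
  ccomp : forall X Y Z, chom Y Z -> chom X Y -> chom X Z;
  ccomp1m : forall X Y (f : chom X Y), ccomp (idC Y) f = f;
  ccompm1 : forall X Y (f : chom X Y), ccomp f (idC X) = f;
  ccompA : forall X Y Z W (h : chom Z W) (g : chom Y Z) (f : chom X Y),
    ccomp h (ccomp g f) = ccomp (ccomp h g) f }.

Arguments chom {c} _ _.
Arguments idC {c} X.
Arguments ccomp {c X Y Z} _ _.

Notation "g ∙ f" := (ccomp g f) (at level 40, left associativity) : cat_scope.

Definition ceq (C : category) (X Y : C) (e : X = Y) : chom X Y :=
  let: erefl := e in idC X.

(* Strictness: the associator and unitors [ceq _] are equalities of        *)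
(* objects, natural on morphisms; the pentagon and triangle then hold by   *)
(* proof irrelevance.                                                      *)
Record strictMonoidal := StrictMonoidal {
  scat :> category;
  unit_ob : scat;
  tens : scat -> scat -> scat;
  tensm : forall X X' Y Y' : scat,
    chom X X' -> chom Y Y' -> chom (tens X Y) (tens X' Y');
  tensm_id : forall X Y : scat, tensm (idC X) (idC Y) = idC (tens X Y);
  tensm_comp : forall (X X' X'' Y Y' Y'' : scat) (f' : chom X' X'')
      (f : chom X X') (g' : chom Y' Y'') (g : chom Y Y'),
    tensm (f' ∙ f) (g' ∙ g) = tensm f' g' ∙ tensm f g;
  tensA : forall X Y Z : scat, tens X (tens Y Z) = tens (tens X Y) Z;
  ten1X : forall X : scat, tens unit_ob X = X;
  tenX1 : forall X : scat, tens X unit_ob = X;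
  tensmA : forall (X X' Y Y' Z Z' : scat) (f : chom X X') (g : chom Y Y')
      (h : chom Z Z'),
    ceq (tensA X' Y' Z') ∙ tensm f (tensm g h)
    = tensm (tensm f g) h ∙ ceq (tensA X Y Z);
  tensm1X : forall (X X' : scat) (f : chom X X'),
    ceq (ten1X X') ∙ tensm (idC unit_ob) f = f ∙ ceq (ten1X X);
  tensmX1 : forall (X X' : scat) (f : chom X X'),
    ceq (tenX1 X') ∙ tensm f (idC unit_ob) = f ∙ ceq (tenX1 X) }.

Arguments unit_ob {s}.
Notation "X ⊗ Y" := (tens X Y) (at level 38, left associativity) : cat_scope.
Notation "f ⊗m g" := (tensm f g) (at level 38, left associativity) : cat_scope.

Record leftDuality (C : strictMonoidal) := LeftDuality {
  ldual : C -> C;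
  lev : forall X, chom (ldual X ⊗ X) unit_ob;
  lcoev : forall X, chom unit_ob (X ⊗ ldual X);
  lzig : forall X,
    ceq (tenX1 X) ∙ (idC X ⊗m lev X) ∙ ceq (esym (tensA X (ldual X) X))
      ∙ (lcoev X ⊗m idC X) ∙ ceq (esym (ten1X X)) = idC X;
  lzag : forall X,
    ceq (ten1X (ldual X)) ∙ (lev X ⊗m idC (ldual X))
      ∙ ceq (tensA (ldual X) X (ldual X))
      ∙ (idC (ldual X) ⊗m lcoev X) ∙ ceq (esym (tenX1 (ldual X)))
    = idC (ldual X) }.

Section StrictDuality.
Variables (C : strictMonoidal) (D : leftDuality C).
Local Notation "X ^*" := (ldual D X) : cat_scope.

Definition ldualm (X Y : C) (a : chom X Y) : chom (Y^*) (X^*) :=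
  ceq (ten1X (X^*)) ∙ (lev D Y ⊗m idC (X^*)) ∙ ceq (tensA (Y^*) Y (X^*))
    ∙ (idC (Y^*) ⊗m (a ⊗m idC (X^*))) ∙ (idC (Y^*) ⊗m lcoev D X)
    ∙ ceq (esym (tenX1 (Y^*))).

Hypothesis dual1 : unit_ob^* = unit_ob.
Hypothesis dualM : forall X Y : C, (X ⊗ Y)^* = Y^* ⊗ X^*.

Lemma lev1_eq : unit_ob^* ⊗ unit_ob = unit_ob :> C.
Proof. by rewrite tenX1. Qed.

Lemma lcoev1_eq : unit_ob = unit_ob ⊗ unit_ob^* :> C.
Proof. by rewrite ten1X. Qed.

Lemma levM_eq X Y : (X ⊗ Y)^* ⊗ (X ⊗ Y) = Y^* ⊗ ((X^* ⊗ X) ⊗ Y).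
Proof. by rewrite dualM !tensA. Qed.

Lemma levM_eq1 Y : Y^* ⊗ (unit_ob ⊗ Y) = Y^* ⊗ Y.
Proof. by rewrite ten1X. Qed.

Lemma lcoevM_eq X Y : X ⊗ ((Y ⊗ Y^*) ⊗ X^*) = (X ⊗ Y) ⊗ (X ⊗ Y)^*.
Proof. by rewrite dualM !tensA. Qed.

Lemma lcoevM_eq1 X : X ⊗ X^* = X ⊗ (unit_ob ⊗ X^*).
Proof. by rewrite ten1X. Qed.

End StrictDuality.

(* The right duality is the inverse of the left one: [rdual X] is a right  *)
(* dual of X with evaluation and coevaluation those of [rdual X].  The     *)
(* canonical isomorphisms 1^* = 1 and (X (x) Y)^* = Y^* (x) X^* being      *)
(* identities means that ev and coev of 1 and of X (x) Y are the expected  *)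
(* composites.                                                             *)
Record rigidMonoidal := RigidMonoidal {
  rmon :> strictMonoidal;
  rldual : leftDuality rmon;
  rdual : rmon -> rmon;
  rdualK : forall X, ldual rldual (rdual X) = X;
  ldualK : forall X, rdual (ldual rldual X) = X;
  dual1 : ldual rldual unit_ob = unit_ob;
  dualM : forall X Y,
    ldual rldual (X ⊗ Y) = ldual rldual Y ⊗ ldual rldual X;
  ev1 : lev rldual unit_ob = ceq (lev1_eq dual1);
  coev1 : lcoev rldual unit_ob = ceq (lcoev1_eq dual1);
  evM : forall X Y,
    lev rldual (X ⊗ Y)
    = lev rldual Y ∙ ceq (levM_eq1 rldual Y)
        ∙ (idC (ldual rldual Y) ⊗m (lev rldual X ⊗m idC Y))
        ∙ ceq (levM_eq dualM X Y);
  coevM : forall X Y,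
    lcoev rldual (X ⊗ Y)
    = ceq (lcoevM_eq dualM X Y)
        ∙ (idC X ⊗m (lcoev rldual Y ⊗m idC (ldual rldual X)))
        ∙ ceq (lcoevM_eq1 rldual X) ∙ lcoev rldual X }.

Section Rigid.
Variable C : rigidMonoidal.
Implicit Types X Y : C.

Definition du X : C := ldual (rldual C) X.
Definition ddu X : C := du (du X).
Definition dum X Y (a : chom X Y) : chom (du Y) (du X) := ldualm (rldual C) a.
Definition ddum X Y (a : chom X Y) : chom (ddu X) (ddu Y) := dum (dum a).
Definition ev X : chom (du X ⊗ X) unit_ob := lev (rldual C) X.
Definition coev X : chom unit_ob (X ⊗ du X) := lcoev (rldual C) X.

Lemma ddu1 : ddu unit_ob = unit_ob.
Proof. by rewrite /ddu /du !dual1. Qed.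

Lemma dduM X Y : ddu (X ⊗ Y) = ddu X ⊗ ddu Y.
Proof. by rewrite /ddu /du !dualM. Qed.

End Rigid.

Record rightAction (k : fieldType) (M : linCat k) (C : rigidMonoidal) :=
  RightAction {
  actob : M -> C -> M;
  actf : forall (A B : M) (X Y : C),
    Mor A B -> chom X Y -> Mor (actob A X) (actob B Y);
  actf_id : forall A X, actf (idM A) (idC X) = idM (actob A X);
  actf_comp : forall (A B D : M) (X Y Z : C) (g : Mor B D) (f : Mor A B)
      (b : chom Y Z) (a : chom X Y),
    actf (g ∘ f) (b ∙ a) = actf g b ∘ actf f a;
  actf_lin : forall (A B : M) (X : C),
    linear (fun f : Mor A B => actf f (idC X));
  actA : forall A X Y, actob A (X ⊗ Y) = actob (actob A X) Y;
  actU : forall A, actob A unit_ob = A;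
  actfA : forall (A B : M) (X X' Y Y' : C) (f : Mor A B) (a : chom X X')
      (b : chom Y Y'),
    eqm (actA B X' Y') ∘ actf f (a ⊗m b)
    = actf (actf f a) b ∘ eqm (actA A X Y);
  actf1 : forall (A B : M) (f : Mor A B),
    eqm (actU B) ∘ actf f (idC unit_ob) = f ∘ eqm (actU A) }.

Section Action.
Variables (k : fieldType) (M : linCat k) (C : rigidMonoidal).
Variable act : rightAction M C.
Implicit Types (A B : M) (X Y : C).

Local Notation "A ◁ X" := (actob act A X)
  (at level 39, left associativity) : cat_scope.
Local Notation "f ◁m a" := (actf act f a)
  (at level 39, left associativity) : cat_scope.

Definition act_functor X : functor M M.
Proof.
exists (fun A => A ◁ X) (fun A B f => f ◁m idC X).
- by move=> A; rewrite actf_id.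
- by move=> A B D g f; rewrite -actf_comp ccomp1m.
Defined.

Definition act_coev A X : Mor A (A ◁ X ◁ du X) :=
  eqm (actA act A X (du X)) ∘ (idM A ◁m coev X) ∘ eqm (esym (actU act A)).

Definition act_ev A X : Mor (A ◁ du X ◁ X) A :=
  eqm (actU act A) ∘ (idM A ◁m ev X) ∘ eqm (esym (actA act A (du X) X)).

(* The closing operator cl_{A,B|X}; the two casts hidden in [act_ev] and   *)
(* [act_coev] are B <| X^** <| X^* = B <| (X^** (x) X^* ) and               *)
(* A <| (X (x) X^* ) = A <| X <| X^*.                                       *)
Definition cl A B X (f : Mor (A ◁ X) (B ◁ ddu X)) : Mor A B :=
  act_ev B (du X) ∘ (f ◁m idC (du X)) ∘ act_coev A X.

Lemma cl_linear A B X : linear (@cl A B X).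
Proof.
move=> c f g; rewrite /cl actf_lin comp_linr.
exact: (comp_linl (act_coev A X)).
Qed.

HB.instance Definition _ A B X :=
  GRing.isLinear.Build k (Mor (A ◁ X) (B ◁ ddu X)) (Mor A B) *:%R
    (@cl A B X) (@cl_linear A B X).

Definition clL A B X : 'Hom(Mor (A ◁ X) (B ◁ ddu X), Mor A B) :=
  linfun (@cl A B X).

Lemma eqmK A B (e : A = B) : eqm (esym e) ∘ eqm e = idM A.
Proof. by case: _ / e => /=; rewrite comp1m. Qed.

Lemma eqmVK A B (e : A = B) : eqm e ∘ eqm (esym e) = idM B.
Proof. by case: _ / e => /=; rewrite comp1m. Qed.

Lemma eqm_comp A B D (e : A = B) (e' : B = D) (e'' : A = D) :
  eqm e' ∘ eqm e = eqm e''.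
Proof.
by case: _ / e' e''; case: _ / e => e''; rewrite comp1m (Prop_irrelevance e'' erefl).
Qed.

Lemma actf_eqml A B X (e : A = B) (e' : A ◁ X = B ◁ X) :
  eqm e ◁m idC X = eqm e'.
Proof. by case: _ / e e' => e'; rewrite actf_id (Prop_irrelevance e' erefl). Qed.

Lemma actf_eqmr A X Y (e : X = Y) (e' : A ◁ X = A ◁ Y) :
  idM A ◁m ceq e = eqm e'.
Proof. by case: _ / e e' => e'; rewrite actf_id (Prop_irrelevance e' erefl). Qed.

Lemma actA_inv A B X X' Y Y' (f : Mor A B) (a : chom X X') (b : chom Y Y') :
  f ◁m a ◁m b
  = eqm (actA act B X' Y') ∘ (f ◁m (a ⊗m b)) ∘ eqm (esym (actA act A X Y)).
Proof. by rewrite actfA -mcompA eqmVK compm1. Qed.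

Lemma act_coev_nat A B X (f : Mor A B) :
  (f ◁m idC X ◁m idC (du X)) ∘ act_coev A X = act_coev B X ∘ f.
Proof.
rewrite /act_coev !mcompA -actfA tensm_id -!mcompA; congr (_ ∘ _).
rewrite [in LHS]mcompA -actf_comp ccomp1m compm1.
suff -> : eqm (esym (actU act B)) ∘ f
    = (f ◁m idC unit_ob) ∘ eqm (esym (actU act A)).
  by rewrite [in RHS]mcompA -actf_comp comp1m ccompm1.
rewrite -[RHS]comp1m -(eqmK (actU act B)) -!mcompA; congr (_ ∘ _).
by rewrite mcompA actf1 -mcompA eqmVK compm1.
Qed.

Lemma act_ev_nat A B X (f : Mor A B) :
  act_ev B X ∘ (f ◁m idC (du X) ◁m idC X) = f ∘ act_ev A X.
Proof.
rewrite /act_ev actA_inv tensm_id !mcompA; congr (_ ∘ _).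
rewrite -(mcompA _ (eqm (esym _))) eqmK compm1 -actf1 -!mcompA; congr (_ ∘ _).
by rewrite -!actf_comp comp1m compm1 ccomp1m ccompm1.
Qed.

Lemma eqm_trans A B D (e : A = B) (e' : B = D) :
  eqm e' ∘ eqm e = eqm (etrans e e').
Proof. exact: eqm_comp. Qed.

Lemma actf_eql A B X (e : A = B) :
  eqm e ◁m idC X = eqm (congr1 (fun A => A ◁ X) e).
Proof. exact: actf_eqml. Qed.

Lemma actf_eqr A X Y (e : X = Y) :
  idM A ◁m ceq e = eqm (congr1 (fun X => A ◁ X) e).
Proof. exact: actf_eqmr. Qed.

Lemma actf_compl A B D X (g : Mor B D) (f : Mor A B) :
  (g ∘ f) ◁m idC X = (g ◁m idC X) ∘ (f ◁m idC X).
Proof. by rewrite -actf_comp ccomp1m. Qed.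

Lemma actf_compr A X Y Z (b : chom Y Z) (a : chom X Y) :
  idM A ◁m (b ∙ a) = (idM A ◁m b) ∘ (idM A ◁m a).
Proof. by rewrite -actf_comp comp1m. Qed.

Lemma act_zig A X :
  act_ev (A ◁ X) X ∘ (act_coev A X ◁m idC X) = idM (A ◁ X).
Proof.
have E := actf_id act A X.
rewrite -(lzig (rldual C) X) !actf_compr !actf_eqr in E; rewrite -[RHS]E {E}.
rewrite /act_ev /act_coev !actf_compl !actf_eql actA_inv -(actf_id act A X).
rewrite actA_inv !mcompA.
do 2 rewrite -?(mcompA _ (eqm _) (eqm _)) ?eqm_trans.
by congr (_ ∘ _ ∘ _ ∘ _ ∘ _); congr eqm.
Qed.

Lemma act_zag A X :
  (act_ev A X ◁m idC (du X)) ∘ act_coev (A ◁ du X) X = idM (A ◁ du X).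
Proof.
have E := actf_id act A (du X).
rewrite -(lzag (rldual C) X) !actf_compr !actf_eqr in E; rewrite -[RHS]E {E}.
rewrite /act_ev /act_coev !actf_compl !actf_eql actA_inv.
rewrite -(actf_id act A (du X)) actA_inv !mcompA.
do 2 rewrite -?(mcompA _ (eqm _) (eqm _)) ?eqm_trans.
by congr (_ ∘ _ ∘ _ ∘ _ ∘ _); congr eqm.
Qed.

Lemma act_adj_inj A B X (u v : Mor (A ◁ X) B) :
  (u ◁m idC (du X)) ∘ act_coev A X = (v ◁m idC (du X)) ∘ act_coev A X ->
  u = v.
Proof.
have tr (w : Mor (A ◁ X) B) :
  w = act_ev B X ∘ (((w ◁m idC (du X)) ∘ act_coev A X) ◁m idC X).
  by rewrite actf_compl mcompA act_ev_nat -mcompA act_zig compm1.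
by move=> uv; rewrite (tr u) uv -tr.
Qed.

Lemma act_epi A B X (e : Mor A B) : epi e -> epi (e ◁m idC X).
Proof.
move=> epi_e Z u v uv; apply: act_adj_inj; apply: epi_e.
by rewrite -!(mcompA _ (act_coev B X)) -!act_coev_nat !(mcompA _ (_ ◁m _)) -!actf_compl uv.
Qed.

Lemma act_projective A X : projective A -> projective (A ◁ X).
Proof.
move=> projA B D e epi_e g.
have [h hE] := projA _ _ _ (@act_epi _ _ (du X) _ epi_e)
  ((g ◁m idC (du X)) ∘ act_coev A X).
exists (act_ev B X ∘ (h ◁m idC X)).
by rewrite mcompA -act_ev_nat -mcompA -actf_compl hE actf_compl mcompA act_ev_nat
   -mcompA act_zig compm1.
Qed.

Definition proj_act (P : Proj M) X : Proj M :=
  MkProj (act_projective (X := X) (proj_objP (p := P))).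

End Action.

(* The coend int^X Hom(A, X)^* . X, functorial in A.                       *)
Section Nakayama.
Variables (k : fieldType) (M : linCat k) (T : canAction M).

Definition dinatural (A Z : M)
    (j : forall X : M, Mor (T (dual (Mor A X)) X) Z) :=
  forall (X Y : M) (f : Mor X Y),
    j Y ∘ cact_map T \1%VF f
    = j X ∘ cact_map T (dualmap (homL A f)) (idM X).

Record nakayama := Nakayama {
  nak :> functor M M;
  naki : forall X A : M, Mor (T (dual (Mor A X)) X) (nak A);
  naki_dinat : forall A : M, dinatural (fun X => naki X A);
  naki_univ : forall (A Z : M)
      (j : forall X : M, Mor (T (dual (Mor A X)) X) Z),
    dinatural j -> exists! h : Mor (nak A) Z, forall X, h ∘ naki X A = j X;
  naki_nat : forall (X A B : M) (f : Mor A B),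
    fmor nak f ∘ naki X A
    = naki X B ∘ cact_map T (dualmap (homR X f)) (idM X) }.

End Nakayama.

Section Traces.
Variables (k : fieldType) (M : linCat k).

Definition trace_family (F : functor M M) :=
  forall P : Proj M, dual (Mor P (F P)).

Definition twisted_trace (F : functor M M) (t : trace_family F) :=
  forall (P Q : Proj M) (f : Mor P Q) (g : Mor Q (F P)),
    t P (g ∘ f) = t Q (fmor F f ∘ g).

Definition canonical_nakayama_trace (T : canAction M) (N : nakayama T)
    (t : trace_family N) :=
  forall (P : Proj M) (X : M) (w : dual (Mor P X)) (f : Mor P X),
    t P (naki N X P ∘ Lambda T w f) = w f.

End Traces.

Section Twisted.
Variables (k : fieldType) (M : linCat k) (C : rigidMonoidal).
Variable act : rightAction M C.

Local Notation "A ◁ X" := (actob act A X)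
  (at level 39, left associativity) : cat_scope.
Local Notation "f ◁m a" := (actf act f a)
  (at level 39, left associativity) : cat_scope.

Definition twist_family (F : functor M M) :=
  forall (A : M) (X : C), Mor (F A ◁ ddu X) (F (A ◁ X)).

Lemma twist1_eq (F : functor M M) (A : M) :
  F A ◁ ddu unit_ob = F (A ◁ unit_ob).
Proof. by rewrite ddu1 !actU. Qed.

Lemma twistM_eq (B : M) (X Y : C) :
  B ◁ ddu (X ⊗ Y) = B ◁ ddu X ◁ ddu Y.
Proof. by rewrite dduM actA. Qed.

Record twisted_module_functor (F : functor M M) (psi : twist_family F) :
    Prop := TwistedModuleFunctor {
  twist_nat : forall (A B : M) (X Y : C) (f : Mor A B) (a : chom X Y),
    psi B Y ∘ (fmor F f ◁m ddum a) = fmor F (f ◁m a) ∘ psi A X;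
  twist1 : forall A : M, psi A unit_ob = eqm (twist1_eq F A);
  twistM : forall (A : M) (X Y : C),
    eqm (congr1 F (actA act A X Y)) ∘ psi A (X ⊗ Y)
    = psi (A ◁ X) Y ∘ (psi A X ◁m idC (ddu Y)) ∘ eqm (twistM_eq (F A) X Y) }.

Definition twisted_module_morphism (F G : functor M M)
    (psiF : twist_family F) (psiG : twist_family G) (xi : nattrans F G) :=
  forall (A : M) (X : C),
    xi (A ◁ X) ∘ psiF A X = psiG A X ∘ (xi A ◁m idC (ddu X)).

Definition nakayama_twist (T : canAction M) (N : nakayama T)
    (psi : twist_family N) :=
  forall (A X : M) (V : C),
    psi A V ∘ (naki N X A ◁m idC (ddu V))
    = naki N (X ◁ ddu V) (A ◁ V)
        ∘ cact_map T (dualmap (clL act A X V)) (idM (X ◁ ddu V))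
        ∘ can_iso T (act_functor act (ddu V)) (dual (Mor A X)) X.

Definition compatible_trace (F : functor M M) (psi : twist_family F)
    (t : trace_family F) :=
  forall (P : Proj M) (X : C) (f : Mor (P ◁ X) (F P ◁ ddu X)),
    t P (cl f) = t (proj_act act P X) (psi P X ∘ f).

End Twisted.

(* Main.v *)
(* The Nakayama functor is controlled by a progenerator [G], the image of   *)
(* the regular module.  Dinaturality shows that the single component        *)
(* [naki N G A : Hom(A, G)^* . G -> N A] is epi.  Hence every morphism from *)
(* a projective object to [N A] factors through [naki N G A], and after     *)
(* acting by [V^**] the same holds for morphisms to [N A <| V^**].          *)
(* Expanding such factorizations in a basis of [Hom(A, G)^*] gives:         *)
(*   - the canonical Nakayama trace is compatible with the module structure *)
(*     of [N];                                                              *)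
(*   - it is nondegenerate: [h : Y -> N P] vanishes as soon as all traces   *)
(*     of [h f], [f : P -> Y], do.                                          *)
(* By compatibility, [t] is compatible iff [xi psiS] and [psiN (xi <| id)]  *)
(* have the same traces against every [f : P <| X -> Sigma P <| X^**], with *)
(* [P] projective; by nondegeneracy, iff they agree at projective objects.  *)
(* Agreement spreads to every [A], which is a cokernel of a morphism        *)
(* between the projectives [V . G], because [Sigma] preserves cokernels and *)
(* the action preserves epimorphisms.                                       *)
Require Import Defs.
From mathcomp Require Import all_boot all_algebra.
From mathcomp Require Import boolp.
From HB Require Import structures.
Import GRing.Theory.
Local Open Scope ring_scope.
Local Open Scope cat_scope.

Set Implicit Arguments.
Unset Strict Implicit.
Unset Printing Implicit Defensive.

(** * Progenerators *)

Definition separating (k : fieldType) (M : linCat k) (G : M) :=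
  forall (A B : M) (u v : Mor A B),
    (forall w : Mor G A, u ∘ w = v ∘ w) -> u = v.

(** Fullness of [Hom(G, -)] as a functor to right [End(G)]-modules, whereas [separating] is its
    faithfulness. *)
Definition dense (k : fieldType) (M : linCat k) (G : M) :=
  forall (A B : M) (phi : Mor G A -> Mor G B), linear phi ->
    (forall (a : Mor G G) (w : Mor G A), phi (w ∘ a) = phi w ∘ a) ->
  exists u : Mor A B, forall w, phi w = u ∘ w.

Definition progenerator (k : fieldType) (M : linCat k) (G : M) :=
  [/\ projective G, separating G & dense G].

Definition is_iso (k : fieldType) (M : linCat k) (A B : M) (i : Mor A B)
    (j : Mor B A) :=
  j ∘ i = idM A /\ i ∘ j = idM B.

(** * The regular module as a progenerator *)

Section ModuleCategory.
Variables (k : fieldType) (R : fdAlg k).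
Implicit Types V W : fdMod R.

Lemma modmor_act V W (f : @Mor k (modcat R) V W) a v :
  vsval f (mod_act a v) = mod_act a (vsval f v).
Proof. exact: (iffLR (modhomP _) (subvsP f)). Qed.

Lemma modmor_comp V W U (g : @Mor k (modcat R) W U)
    (f : @Mor k (modcat R) V W) v :
  vsval (g ∘ f) v = vsval g (vsval f v).
Proof. by rewrite [X in fun_of_lfun X]modcompE comp_lfunE. Qed.

Lemma modmor_eq V W (f g : @Mor k (modcat R) V W) :
  (forall v, vsval f v = vsval g v) -> f = g.
Proof. by move=> fg; apply: val_inj; apply/lfunP. Qed.

Lemma modmor_exists V W (f : 'Hom(V, W)) :
    (forall a v, f (mod_act a v) = mod_act a (f v)) ->
  {g : @Mor k (modcat R) V W | forall v, vsval g v = f v}.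
Proof.
move=> /(modhomP f) fP; exists (vsproj (modhom V W) f) => v.
by rewrite vsprojK.
Qed.

Definition regmod : fdMod R :=
  @FdMod k R R (@amul k R) (@amul1a k R)
    (fun a b c => esym (amulA a b c)) (@amul_linr k R) (@amul_linl k R).

Definition orbit V (v : V) : 'Hom(R, V) := linfun (fun a : R => mod_act a v).

Lemma orbitE V (v : V) a : orbit v a = mod_act a v.
Proof.
pose L := GRing.isLinear.Build k R V *:%R (fun a => mod_act a v)
  (@mod_act_linl k R V v).
pose F : {linear R -> V} := HB.pack (fun a => mod_act a v) L.
by rewrite /orbit (lfunE F).
Qed.

Lemma regmod_mor V (v : V) :
  {g : @Mor k (modcat R) regmod V | forall a : R, vsval g a = mod_act a v}.
Proof.
have [|g gE] := @modmor_exists regmod V (orbit v).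
  by move=> a b; rewrite !orbitE mod_actM.
by exists g => a; rewrite gE orbitE.
Qed.

Lemma regmod_morE V (g : @Mor k (modcat R) regmod V) (a : R) :
  vsval g a = mod_act a (vsval g (aone R)).
Proof. by rewrite -(modmor_act g a) /= amula1. Qed.

Lemma regmod_separating : separating (regmod : modcat R).
Proof.
move=> V W u v uv; apply: modmor_eq => x.
have [g gE] := regmod_mor x.
by rewrite -(mod_act1 x) -gE -!modmor_comp uv.
Qed.

(** Evaluation at 1 identifies [Hom(R, V)] with [V], and precomposition with a right multiplication
    becomes the action on [V]; so [phi] becomes a module morphism. *)
Lemma regmod_dense : dense (regmod : modcat R).
Proof.
move=> V W phi phi_lin phi_comp.
pose o (x : V) := sval (regmod_mor x).
have oE (x : V) a : vsval (o x) a = mod_act a x := svalP (regmod_mor x) a.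
have wE (w : @Mor k (modcat R) regmod V) : w = o (vsval w (aone R)).
  by apply: modmor_eq => a; rewrite oE regmod_morE.
have o_lin c x y : o (c *: x + y) = c *: o x + o y.
  apply: modmor_eq => a.
  by rewrite vsvalP add_lfunE scale_lfunE !oE mod_act_linr.
pose f (x : V) := vsval (phi (o x)) (aone R).
have f_lin : linear f.
  by move=> c x y; rewrite /f o_lin phi_lin vsvalP add_lfunE scale_lfunE.
pose L := GRing.isLinear.Build k V W *:%R f f_lin.
pose F : {linear V -> W} := HB.pack f L.
have FE x : linfun F x = f x by rewrite lfunE.
have [|u uE] := @modmor_exists V W (linfun F).
  move=> a x; rewrite !FE /f -regmod_morE.
  have [g gE] := @regmod_mor regmod a.
  have -> : o (mod_act a x) = o x ∘ g.
    by apply: modmor_eq => b; rewrite modmor_comp !oE gE /= mod_actM.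
  by rewrite phi_comp modmor_comp gE /= amul1a.
exists u => w; apply: modmor_eq => a.
rewrite modmor_comp (regmod_morE w) modmor_act uE FE /f -wE.
exact: regmod_morE.
Qed.

Section Coinduced.
Variable W : vectType k.

Definition coind_act (a : R) (f : 'Hom(R, W)) : 'Hom(R, W) :=
  (f \o linfun (fun b : R => amul b a : R))%VF.

Lemma coind_actE a f b : coind_act a f b = f (amul b a).
Proof.
pose L := GRing.isLinear.Build k R R *:%R (fun b => amul b a) (amul_linl a).
pose F : {linear R -> R} := HB.pack (fun b => amul b a) L.
by rewrite comp_lfunE (lfunE F).
Qed.

Definition coind : fdMod R.
Proof.
apply: (@FdMod k R 'Hom(R, W) coind_act).
- by move=> f; apply/lfunP=> b; rewrite coind_actE amula1.
- by move=> a b f; apply/lfunP=> c; rewrite !coind_actE amulA.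
- move=> a c f g; apply/lfunP=> b.
  by rewrite add_lfunE scale_lfunE !coind_actE add_lfunE scale_lfunE.
- move=> f c a b; apply/lfunP=> d.
  by rewrite add_lfunE scale_lfunE !coind_actE amul_linr linearP.
Defined.

(** Coinduction is right adjoint to the forgetful functor to vector spaces; [u] is the adjunct of
    [p]. *)
Lemma coind_mor V (p : 'Hom(V, W)) :
  {u : @Mor k (modcat R) V coind |
    forall v (a : R), (vsval u v : 'Hom(R, W)) a = p (mod_act a v)}.
Proof.
pose f v : coind := (p \o orbit v)%VF.
have fE v a : (f v : 'Hom(R, W)) a = p (mod_act a v).
  by rewrite comp_lfunE orbitE.
have f_lin : linear f.
  move=> c x y; apply/lfunP=> a.
  by rewrite add_lfunE scale_lfunE !fE mod_act_linr linearP.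
pose L := GRing.isLinear.Build k V coind *:%R f f_lin.
pose F : {linear V -> coind} := HB.pack f L.
have [|u uE] := @modmor_exists V coind (linfun F).
  move=> a x; rewrite !lfunE; apply/lfunP=> b.
  by rewrite fE -mod_actM /= coind_actE fE.
by exists u => v a; rewrite uE lfunE fE.
Qed.

End Coinduced.

(* With [p] a projection whose kernel is the image [U] of [e], the morphism *)
(* [v |-> (a |-> p (a v))] to the coinduced module kills [U] and no other   *)
(* vector, and it is 0 as [e] is epi.  This avoids quotient modules.        *)
Lemma modmor_epi V W (e : @Mor k (modcat R) V W) :
  epi e -> forall w, exists v, vsval e v = w.
Proof.
move=> epi_e w; pose U := limg (vsval e).
have [u uE] := coind_mor (\1 - projv U)%VF.
have uw0 : u = 0.
  apply: epi_e; apply: modmor_eq => v; apply/lfunP=> a.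
  rewrite !modmor_comp uE -modmor_act add_lfunE opp_lfunE id_lfunE.
  rewrite projv_id ?memv_img ?memvf // subrr.
  by rewrite linear0 !lfunE.
have /lfunP/(_ (aone R)) :=
  congr1 (fun f : @Mor k (modcat R) W (coind W) => vsval f w : 'Hom(R, W)) uw0.
rewrite uE mod_act1 add_lfunE opp_lfunE id_lfunE linear0 !lfunE /= => /eqP.
rewrite subr_eq0 => /eqP wU.
have: w \in U by rewrite wU memv_proj.
by case/memv_imgP=> v _ ->; exists v.
Qed.

Lemma regmod_projective : projective (regmod : modcat R).
Proof.
move=> V W e /modmor_epi e_surj g.
have [v vE] := e_surj (vsval g (aone R)).
have [h hE] := regmod_mor v; exists h; apply: modmor_eq => a.
by rewrite modmor_comp hE modmor_act vE -regmod_morE.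
Qed.

End ModuleCategory.

(** * Transport of a progenerator along an equivalence *)

Section Equivalences.
Variables (k : fieldType) (M N : linCat k).

Definition weak_equivalence (F : functor M N) :=
  [/\ linear_functor F,
      forall (A B : M) (u v : Mor A B), fmor F u = fmor F v -> u = v,
      forall (A B : M) (v : Mor (F A) (F B)), exists u, fmor F u = v &
      forall B : N, exists A i j, @is_iso k N (F A) B i j].

Lemma linear_equivalent_weak :
  linear_equivalent M N -> exists F, weak_equivalence F.
Proof.
move=> [F [G [linF _ [a [b ab]] [c [d cd]]]]]; exists F.
have injF (A B : M) (u v : Mor A B) : fmor F u = fmor F v -> u = v.
  move=> uv; have := nt_nat a u; have := nt_nat a v; rewrite /= uv => -> uv'.
  by rewrite -[u]compm1 -[v]compm1 -(ab A).2 !mcompA uv'.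
have injG (A B : N) (u v : Mor A B) : fmor G u = fmor G v -> u = v.
  move=> uv; have := nt_nat c u; have := nt_nat c v; rewrite /= uv => -> uv'.
  by rewrite -[u]compm1 -[v]compm1 -(cd A).2 !mcompA uv'.
split=> //.
(* The preimage is [G v] conjugated by the isomorphism of [G F] with the identity; faithfulness of
   [G] then gives [F u = v]. *)
- move=> A B v; exists (a B ∘ fmor G v ∘ b A); apply: injG.
  set u := _ ∘ b A; have /= nu := nt_nat a u.
  rewrite -[LHS]comp1m -(ab B).1 -mcompA nu /u -!mcompA (ab A).1 compm1.
  by rewrite mcompA (ab B).1 comp1m.
- by move=> B; exists (G B), (c B), (d B); split; case: (cd B).
Qed.

Section Transport.
Variables (F : functor M N) (F_eq : weak_equivalence F).
Variables (P : N) (G : M) (i : Mor (F G) P) (j : Mor P (F G)).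
Hypothesis ij : is_iso i j.

Lemma weak_equivalence_epi (A B : M) (e : Mor A B) :
  epi e -> epi (fmor F e).
Proof.
case: F_eq => _ injF fullF surF epi_e Z u v.
have [Y [m [n [_ mn]]]] := surF Z.
have [u' u'E] := fullF _ _ (n ∘ u).
have [v' v'E] := fullF _ _ (n ∘ v) => uv.
rewrite -[u]comp1m -[v]comp1m -mn -!mcompA -u'E -v'E; congr (_ ∘ fmor F _).
by apply/epi_e/injF; rewrite !fmor_comp u'E v'E -!mcompA uv.
Qed.

Lemma weak_equivalence_projective : projective P -> projective G.
Proof.
move=> projP A B e /weak_equivalence_epi epi_e g.
have [ji1 _] := ij; have [_ injF fullF _] := F_eq.
have [h hE] := projP _ _ _ epi_e (fmor F g ∘ j).
have [h' h'E] := fullF _ _ (h ∘ i).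
exists h'; apply: injF.
by rewrite fmor_comp h'E mcompA hE -mcompA ji1 compm1.
Qed.

Lemma weak_equivalence_separating : separating P -> separating G.
Proof.
move=> sepP A B u v uv; have [_ ij1] := ij; have [_ injF fullF _] := F_eq.
apply/injF/sepP=> w; have [w' w'E] := fullF _ _ (w ∘ i).
rewrite -[w]compm1 -ij1 !(mcompA _ i) -w'E !mcompA.
by rewrite -!fmor_comp uv.
Qed.

Lemma weak_equivalence_dense : dense P -> dense G.
Proof.
move=> denP A B phi phi_lin phi_comp.
have [ji1 ij1] := ij; have [linF injF fullF _] := F_eq.
(* [pre] turns maps out of [P] into maps out of [G], through [i] and fullness; [psi] is [phi]
   conjugated by this bijection. *)
pose pre (w : Mor P (F A)) := sval (cid (fullF _ _ (w ∘ i))).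
have preE w : fmor F (pre w) = w ∘ i := svalP (cid (fullF _ _ (w ∘ i))).
pose psi w := fmor F (phi (pre w)) ∘ j.
have [||u uE] := denP _ _ psi.
- move=> c v w; rewrite /psi -[RHS](comp_linl j) -linF -phi_lin.
  congr (fmor F (phi _) ∘ j); apply: injF.
  by rewrite linF !preE; apply: (comp_linl i).
- move=> a w; rewrite /psi; have [b bE] := fullF _ _ (j ∘ a ∘ i).
  have -> : pre (w ∘ a) = pre w ∘ b.
    apply: injF; rewrite fmor_comp !preE bE !mcompA -(mcompA w i j) ij1.
    by rewrite compm1.
  by rewrite phi_comp fmor_comp bE -!mcompA ij1 compm1 !mcompA.
- have [u' u'E] := fullF _ _ u; exists u' => w; apply/injF.
  rewrite fmor_comp u'E -[fmor F w]compm1 -ji1 (mcompA _ j i).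
  rewrite (mcompA u) -uE /psi.
  have -> : pre (fmor F w ∘ j) = w.
    by apply: injF; rewrite preE -mcompA ji1 compm1.
  by rewrite -mcompA ji1 compm1.
Qed.

End Transport.
End Equivalences.

Lemma finite_abelian_progenerator (k : fieldType) (M : linCat k) :
  finite_abelian M -> exists G : M, progenerator G.
Proof.
move=> [R /linear_equivalent_weak [F F_eq]].
have [_ _ _ surF] := F_eq; have [G [i [j ij]]] := surF (regmod R).
exists G; split.
- by apply: (weak_equivalence_projective F_eq ij); apply: regmod_projective.
- by apply: (weak_equivalence_separating F_eq ij); apply: regmod_separating.
- by apply: (weak_equivalence_dense F_eq ij); apply: regmod_dense.
Qed.

(** * Linear functors, copowers and presentations by a progenerator *)

Lemma fmor0 (k : fieldType) (M N : linCat k) (F : functor M N) (A B : M) :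
  linear_functor F -> fmor F (0 : Mor A B) = 0.
Proof.
move=> linF.
by have := linF A B (-1) 0 0; rewrite scaler0 addr0 scaleN1r addNr.
Qed.

Section LinearCategories.
Variables (k : fieldType) (M : linCat k).
Implicit Types A B D : M.

Lemma comp0m A B D (f : Mor A B) : (0 : Mor B D) ∘ f = 0.
Proof. exact: (linear0 (compr f)). Qed.

Lemma compBl A B D (f : Mor A B) (g h : Mor B D) :
  (g - h) ∘ f = g ∘ f - h ∘ f.
Proof. exact: (linearB (compr f)). Qed.

Lemma cokernel_epi A B D (f : Mor A B) (g : Mor B D) :
  is_cokernel f g -> epi g.
Proof.
move=> [gf0 univ] Z u v uv; have [|w [_ uniq_w]] := univ Z (v ∘ g).
  by rewrite -mcompA gf0 linear0.
by rewrite -(uniq_w u uv) -(uniq_w v).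
Qed.

End LinearCategories.

Section CanonicalAction.
Variables (k : fieldType) (M : linCat k) (T : canAction M).
Implicit Types (V W : vectType k) (A B : M).

Local Notation unit := (cact_unit T).

Lemma cact_map_unit V W A B (a : 'Hom(V, W)) (f : Mor A B) v :
  cact_map T a f ∘ unit V A v = unit W B (a v) ∘ f.
Proof. by rewrite cact_adjV_unit !comp_lfunE lfunE. Qed.

Definition cact_proj V A (i : 'I_(\dim {:V})) : Mor (T V A) A :=
  cact_adjV T (scalar_hom A (linfun (coord (vbasis {:V}) i : V -> k^o))).

(** A basis of [V] exhibits [V . A] as a finite direct sum of copies of [A]. Linear functors
    preserve this decomposition, so [F(V . A)] can be handled like [V . F(A)]. *)
Lemma cact_id_sum V A :
  idM (T V A) =
    \sum_(i < \dim {:V}) unit V A (vbasis {:V})`_i ∘ cact_proj A i.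
Proof.
apply: cact_hom_eq => v; rewrite comp_suml comp1m.
rewrite [in LHS](coord_vbasis (memvf v)) linear_sum; apply: eq_bigr => i _.
by rewrite -mcompA cact_adjV_unit scalar_homE lfunE /= !linearZ /= compm1.
Qed.

Lemma cact_projective V A : projective A -> projective (T V A).
Proof.
move=> projA B D e epi_e g.
have lift (i : 'I_(\dim {:V})) : {h | e ∘ h = g ∘ unit V A (vbasis {:V})`_i}.
  exact/cid/projA.
exists (\sum_(i < \dim {:V}) sval (lift i) ∘ cact_proj A i).
rewrite comp_sumr -[RHS]compm1 cact_id_sum comp_sumr; apply: eq_bigr => i _.
by rewrite !mcompA (svalP (lift i)).
Qed.

Section FunctorOfAction.
Variables (F : functor M M) (linF : linear_functor F).

Lemma fmor_cact_id_sum V A : idM (F (T V A)) =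
  \sum_(i < \dim {:V})
    fmor F (unit V A (vbasis {:V})`_i) ∘ fmor F (cact_proj A i).
Proof.
rewrite -fmor_id cact_id_sum.
have FD : {morph (@fmor _ _ _ F (T V A) (T V A)) : x y / x + y}.
  by move=> x y; have := linF 1 x y; rewrite !scale1r.
rewrite (big_morph (fmor F) FD (fmor0 _ _ linF)).
by apply: eq_bigr => i _; rewrite fmor_comp.
Qed.

Lemma fmor_cact_hom_eq V A B (g h : Mor (F (T V A)) B) :
  (forall v, g ∘ fmor F (unit V A v) = h ∘ fmor F (unit V A v)) -> g = h.
Proof.
move=> gh; rewrite -[g]compm1 -[h]compm1 fmor_cact_id_sum !comp_sumr.
by apply: eq_bigr => i _; rewrite !mcompA gh.
Qed.

Lemma fmor_cact_expand V A B (f : Mor B (F (T V A))) :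
  exists (n : nat) (v : 'I_n -> V) (h : 'I_n -> Mor B (F A)),
    f = \sum_i fmor F (unit V A (v i)) ∘ h i.
Proof.
exists (\dim {:V}), (fun i => (vbasis {:V})`_i).
exists (fun i => fmor F (cact_proj A i) ∘ f).
rewrite -[LHS]comp1m fmor_cact_id_sum comp_suml.
by apply: eq_bigr => i _; rewrite mcompA.
Qed.

End FunctorOfAction.

Lemma linear_functor_id : linear_functor (functor_id M).
Proof. by []. Qed.

Section Progenerator.
Variables (G : M) (genG : progenerator G).

Definition gen_ev A : Mor (T (Mor G A) G) A := cact_adjV T \1%VF.

Lemma gen_ev_unit A w : gen_ev A ∘ unit (Mor G A) G w = w.
Proof. by rewrite cact_adjV_unit id_lfunE. Qed.

(* [T (Mor G A) G] plays the role of a free cover of [A], and its relations *)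
(* are the morphisms from [G] to it which [gen_ev A] kills.                 *)
Definition gen_relations A : {vspace Mor G (T (Mor G A) G)} :=
  lker (homL G (gen_ev A)).

Definition gen_rel A : Mor (T (subvs_of (gen_relations A)) G) (T (Mor G A) G) :=
  cact_adjV T (linfun vsval).

(** The difference of [unit (w ∘ a)] and [unit w ∘ a] is a relation. So if [h] kills the relations,
    [w |-> h ∘ unit w] is [End(G)]-linear, and density yields the factorization; separation makes it
    unique. *)
Lemma gen_cokernel A : is_cokernel (gen_rel A) (gen_ev A).
Proof.
case: genG => _ sepG denG; split.
  apply: cact_hom_eq => v; rewrite -mcompA cact_adjV_unit lfunE comp0m /=.
  by have := subvsP v; rewrite memv_ker lfunE => /eqP.
move=> Z h h0.
have hker (w : Mor G _) : gen_ev A ∘ w = 0 -> h ∘ w = 0.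
  move=> w0; have wK : w \in gen_relations A.
    by rewrite memv_ker lfunE; apply/eqP.
  have <- : gen_rel A ∘ unit _ G (Subvs wK) = w.
    by rewrite cact_adjV_unit lfunE.
  by rewrite mcompA h0 comp0m.
have [||u uE] := denG A Z (fun w => h ∘ unit _ G w).
- by move=> c v w; rewrite !linearP.
- move=> a w; apply/eqP; rewrite -subr_eq0 -mcompA -linearB /= hker //.
  by rewrite linearB /= mcompA !gen_ev_unit subrr.
exists u; split.
  by apply: cact_hom_eq => w; rewrite uE -mcompA gen_ev_unit.
move=> u' u'E; apply: sepG => w.
by rewrite -uE -u'E -mcompA gen_ev_unit.
Qed.

End Progenerator.
End CanonicalAction.

(** * The Nakayama functor and nondegeneracy of its trace *)

Section NakayamaFunctor.
Variables (k : fieldType) (M : linCat k) (T : canAction M) (N : nakayama T).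

Local Notation unit := (cact_unit T).

(** Dinaturality on elements: a morphism composed on the right is absorbed into the functional,
    which moves the expression to the component at its source. *)
Lemma naki_unit_dinat (A X Y : M) (f : Mor X Y) (w : dual (Mor A Y)) :
  naki N Y A ∘ unit _ Y w ∘ f = naki N X A ∘ unit _ X (w \o homL A f)%VF.
Proof.
have /(congr1 (fun g => g ∘ unit _ X w)) := @naki_dinat _ _ _ N A _ _ f.
by rewrite -!mcompA !cact_map_unit id_lfunE compm1 lfunE.
Qed.

(** Tested on maps from [G], every component of the coend reduces to the one at [G]; uniqueness in
    the universal property concludes. *)
Lemma naki_epi (G A : M) : separating G -> epi (naki N G A).
Proof.
move=> sepG Z u v uv.
have [h [_ uniq_h]] : exists! h, forall X, h ∘ naki N X A = u ∘ naki N X A.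
  by apply: naki_univ => X Y f; rewrite -!mcompA naki_dinat.
rewrite -(uniq_h u) // -(uniq_h v) // => X.
apply: cact_hom_eq => w; apply: sepG => f.
by rewrite -!mcompA !(mcompA (naki _ _ _)) naki_unit_dinat !mcompA uv.
Qed.

Lemma nakayama_trace_nondegenerate (G : M) (t : trace_family N) (P : Proj M)
    (Y : M) (h : Mor Y (N P)) :
    progenerator G -> canonical_nakayama_trace t ->
  (forall f : Mor P Y, t P (h ∘ f) = 0) -> h = 0.
Proof.
move=> [projG sepG _] tP th0; apply: (sepG) => y; rewrite comp0m.
have [y' y'E] := projG _ _ _ (naki_epi (A := P) sepG) (h ∘ y).
have [n [w [a aE]]] := fmor_cact_expand (@linear_functor_id k M) y'.
(* Dinaturality gathers the lift of [h ∘ y] into one functional [v], whose values [v f] are the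
   traces of [h ∘ y ∘ f]. *)
pose v : dual (Mor P G) := \sum_i (w i \o homL P (a i))%VF.
have hyE : h ∘ y = naki N G P ∘ unit _ G v.
  rewrite -y'E aE /v !linear_sum /=; apply: eq_bigr => i _ /=.
  by rewrite mcompA naki_unit_dinat.
suff v0 : v = 0 by rewrite hyE v0 linear0 linear0.
by apply/lfunP=> f; rewrite -tP /Lambda mcompA -hyE -mcompA th0 lfunE.
Qed.

End NakayamaFunctor.

(** * The twisted module structure and compatibility of traces *)

Section TwistedTraces.
Variables (k : fieldType) (M : linCat k) (C : rigidMonoidal).
Variables (act : rightAction M C).

Local Notation "A ◁ X" := (actob act A X)
  (at level 39, left associativity) : cat_scope.
Local Notation "f ◁m a" := (actf act f a)
  (at level 39, left associativity) : cat_scope.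

Lemma dum_id (X : C) : dum (idC X) = idC (du X).
Proof.
by rewrite /dum /ldualm tensm_id tensm_id ccompm1; apply: lzag.
Qed.

Lemma cl_comp (A B D : M) (X : C) (g : Mor B D)
    (f : Mor (A ◁ X) (B ◁ ddu X)) : cl ((g ◁m idC (ddu X)) ∘ f) = g ∘ cl f.
Proof.
rewrite /cl /ddu actf_compl (mcompA (act_ev _ _ _)) act_ev_nat.
by rewrite -!mcompA.
Qed.

Lemma cl_precomp (A B D : M) (X : C) (f : Mor (B ◁ X) (D ◁ ddu X))
    (g : Mor A B) : cl (f ∘ (g ◁m idC X)) = cl f ∘ g.
Proof.
rewrite /cl actf_compl -(mcompA _ _ (act_coev act A X)).
by rewrite -(mcompA (_ ◁m _) _ (act_coev act A X)) act_coev_nat !mcompA.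
Qed.

Lemma act_linear (X : C) : linear_functor (act_functor act X).
Proof. by move=> A B; apply: actf_lin. Qed.

Lemma twist_natl (F : functor M M) (psi : twist_family act F)
    (A B : M) (X : C) (f : Mor A B) : twisted_module_functor psi ->
  psi B X ∘ (fmor F f ◁m idC (ddu X)) = fmor F (f ◁m idC X) ∘ psi A X.
Proof. by move/twist_nat => psi_nat; rewrite -psi_nat /ddum !dum_id. Qed.

Section NakayamaTwist.
Variables (T : canAction M) (N : nakayama T) (psi : twist_family act N).
Hypothesis psiP : nakayama_twist psi.

Local Notation unit := (cact_unit T).

(** The defining equation of [psi] on elements: the canonical isomorphism disappears, and a
    functional [w] is sent to [w] composed with the closing operator. *)
Lemma nakayama_twist_unit (A X : M) (V : C) (w : dual (Mor A X)) :
  psi A V ∘ ((naki N X A ∘ unit _ X w) ◁m idC (ddu V)) =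
  naki N (X ◁ ddu V) (A ◁ V) ∘ unit _ (X ◁ ddu V) (w \o clL act A X V)%VF.
Proof.
rewrite actf_compl mcompA psiP -!mcompA.
have /= -> := can_iso_unit T (act_linear (ddu V)) X w.
by rewrite cact_map_unit compm1 lfunE.
Qed.

(** After testing on functionals at [G], this is naturality of the closing operator in its
    source. *)
Lemma nakayama_twist_nat (G A B : M) (V : C) (f : Mor A B) : separating G ->
  psi B V ∘ (fmor N f ◁m idC (ddu V)) = fmor N (f ◁m idC V) ∘ psi A V.
Proof.
move=> sepG.
apply: (act_epi (act := act) (X := ddu V) (naki_epi (N := N) (A := A) sepG)).
apply: (fmor_cact_hom_eq (act_linear (ddu V))) => w /=.
rewrite -!mcompA -!actf_compl nakayama_twist_unit.
rewrite (mcompA (fmor N f)) naki_nat -mcompA cact_map_unit compm1 lfunE /=.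
rewrite nakayama_twist_unit mcompA naki_nat -mcompA cact_map_unit compm1 lfunE.
congr (_ ∘ unit _ _ _); apply/lfunP=> g.
by rewrite !comp_lfunE !lfunE /= /compr cl_precomp.
Qed.

(** By linearity [g] may be taken of the form [(i_G(w) <| id) ∘ h], where [i_G(w)] is
    [naki N G P ∘ unit _ G w]; both traces then equal [w (cl h)]. *)
Lemma nakayama_trace_compatible (G : M) (t : trace_family N) :
  progenerator G -> canonical_nakayama_trace t -> compatible_trace psi t.
Proof.
move=> [projG sepG _] tP P X g.
have [g' g'E] := act_projective (act := act) (X := X) (@proj_objP _ _ P)
  (act_epi (act := act) (X := ddu X) (naki_epi (N := N) (A := P) sepG)) g.
have [n [w [h hE]]] := fmor_cact_expand (act_linear (ddu X)) g'.
have gE : g = \sum_i ((naki N G P ∘ unit _ G (w i)) ◁m idC (ddu X)) ∘ h i.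
  rewrite -g'E hE comp_sumr; apply: eq_bigr => i _.
  by rewrite actf_compl mcompA.
rewrite gE comp_sumr !linear_sum; apply: eq_bigr => i _ /=.
rewrite cl_comp mcompA nakayama_twist_unit -!mcompA.
by rewrite [LHS]tP (tP (proj_act act P X)) comp_lfunE lfunE.
Qed.

End NakayamaTwist.
End TwistedTraces.

Theorem theorem1p1 (k : fieldType) (C : rigidMonoidal) (M : linCat k)
    (finM : finite_abelian M) (act : rightAction M C)
    (T : canAction M) (N : nakayama T)
    (tN : trace_family N) (tNP : canonical_nakayama_trace tN)
    (psiN : twist_family act N) (psiNP : nakayama_twist psiN)
    (Sigma : functor M M)
    (linS : linear_functor Sigma) (rexS : right_exact Sigma)
    (psiS : twist_family act Sigma) (psiSP : twisted_module_functor psiS)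
    (t : trace_family Sigma) (tP : twisted_trace t)
    (xi : nattrans Sigma N)
    (t_xi : forall (P : Proj M) (f : Mor P (Sigma P)),
       t P f = tN P (xi P ∘ f)) :
  compatible_trace psiS t <-> twisted_module_morphism psiS psiN xi.
Proof.
have [G genG] := finite_abelian_progenerator finM.
have [projG sepG _] := genG.
have tcl (P : Proj M) X (f : Mor (actob act P X) (actob act (Sigma P) (ddu X))) :
  t P (cl f) = tN (proj_act act P X)
    (psiN P X ∘ (actf act (xi P) (idC (ddu X)) ∘ f)).
  by rewrite t_xi -cl_comp (nakayama_trace_compatible psiNP genG tNP).
split=> [t_compat A X|xi_mor P X f]; last by rewrite tcl t_xi !mcompA xi_mor.
have xi_proj (P : Proj M) : xi (actob act P X) ∘ psiS P X =
    psiN P X ∘ actf act (xi P) (idC (ddu X)).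
  apply/eqP; rewrite -subr_eq0; apply/eqP.
  apply: (nakayama_trace_nondegenerate (P := proj_act act P X) genG tNP) => f.
  by rewrite compBl linearB -!mcompA /= -tcl t_compat t_xi subrr.
(* The free cover of [A] by [G]; the equation at [A] is tested after precomposing with the image of
   [gen_ev A] under [Sigma] and the action. *)
pose P := MkProj (cact_projective (T := T) (V := Mor G A) projG).
have epiS := cokernel_epi (rexS _ _ _ _ _ (gen_cokernel T genG A)).
apply: (act_epi (act := act) (X := ddu X) epiS).
rewrite -!mcompA twist_natl // mcompA nt_nat -mcompA (xi_proj P).
rewrite -actf_compl nt_nat actf_compl !mcompA.
by rewrite (nakayama_twist_nat psiNP _ _ sepG).
Qed.
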